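(* EDF is a $3$-competitive algorithm for preemptive semi-online machine minimization when all processing times are equal (i.e. $p_j=p$ for all jobs $j$); that is, EDF run on $3m$ machines produces a feasible schedule, where $m$ is the optimal number of machines.
   Context: Machine minimization with deadlines: each job $j$ of a finite instance has integer release date $r_j$, processing time $p_j$ and deadline $d_j$. A feasible preemptive schedule on a given number of identical machines processes each job for $p_j$ units within $[r_j,d_j]$, each machine processing at most one job at a time, no job on two machines at once; preemption and migration allowed. $m$ is the minimum number of machines admitting a feasible schedule. Semi-online: jobs become known at their release dates, and $m$ is known in advance. $c$-competitive: always produces a feasible schedule with at most $c\cdot m$ machines. The Earliest Deadline First algorithm (EDF) on $k$ machines makes decisions at integer times and at each time processes the $k$ released, unfinished jobs with smallest deadlines, ties broken in favor of earlier release date, then smaller index. *)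

(* Defs.v *)
From HB Require Import structures.
From mathcomp Require Import all_boot all_order all_algebra.
From mathcomp Require Import all_classical all_reals all_analysis.

Set Implicit Arguments.
Unset Strict Implicit.
Unset Printing Implicit Defensive.

Import Order.TTheory GRing.Theory Num.Theory.
Local Open Scope classical_set_scope.
Local Open Scope ring_scope.

Record instance (n : nat) := Instance {
  release : 'I_n -> int;
  proc : 'I_n -> nat;
  deadline : 'I_n -> int }.

Definition equal_processing_times (n : nat) (I : instance n) : Prop :=
  exists p : nat, forall j : 'I_n, proc I j = p.

(* Time is continuous: [S i t] is the job, if any, that machine [i] processes
   at the real time [t]. The type ensures that a machine processes at most one
   job at a time. *)
Definition schedule (R : realType) (k n : nat) := 'I_k -> R -> option 'I_n.

Definition processed (R : realType) (k n : nat) (S : schedule R k n)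
  (j : 'I_n) : set R := [set t | exists i, S i t = Some j].

Record feasible (R : realType) (k n : nat) (I : instance n)
    (S : schedule R k n) : Prop := Feasible {
  feasible_measurable : forall (i : 'I_k) (j : 'I_n),
    measurable [set t | S i t = Some j];
  feasible_window : forall (i : 'I_k) (j : 'I_n) (t : R),
    S i t = Some j -> (release I j)%:~R <= t <= (deadline I j)%:~R;
  feasible_nonparallel : forall (i i' : 'I_k) (j : 'I_n) (t : R),
    S i t = Some j -> S i' t = Some j -> i = i';
  feasible_volume : forall j : 'I_n,
    lebesgue_measure (processed S j) = ((proc I j)%:R)%:E }.

(* If some window is shorter than its processing time, no number of machines
   suffices, and then no [m] satisfies this predicate. *)
Definition optimal_machines (R : realType) (n : nat) (I : instance n)
  (m : nat) : Prop :=
  (exists S : schedule R m n, feasible I S) /\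
  (forall (k : nat) (S : schedule R k n), feasible I S -> (m <= k)%N).

(* An algorithm is given the optimum [m] in advance, and uses [K m] machines. *)
Definition algorithm (R : realType) (K : nat -> nat) :=
  forall (m n : nat), instance n -> schedule R (K m) n.

(* The data of the job of index [a], if there is one and it has been released
   by time [t]. *)
Definition known (R : realType) (n : nat) (I : instance n) (t : R) (a : nat) :
    option (int * nat * int) :=
  if insub a is Some j then
    if (release I j)%:~R <= t
    then Some (release I j, proc I j, deadline I j) else None
  else None.

(* What is processed at time [t] depends only on [m] and on the jobs released
   by time [t]; neither later jobs nor the number of jobs may be used. *)
Definition semi_online (R : realType) (K : nat -> nat) (A : algorithm R K) :
    Prop :=
  forall (m n n' : nat) (I : instance n) (I' : instance n') (t : R),
    known I t =1 known I' t ->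
    forall i : 'I_(K m),
      omap (@nat_of_ord n) (A m n I i t) =
      omap (@nat_of_ord n') (A m n' I' i t).

Definition competitive (R : realType) (c : R) (K : nat -> nat)
  (A : algorithm R K) (C : forall n : nat, instance n -> Prop) : Prop :=
  forall (m n : nat) (I : instance n),
    C n I -> optimal_machines R I m ->
    (K m)%:R <= c * m%:R /\ feasible I (A m n I).

Definition edf_le (n : nat) (I : instance n) (j j' : 'I_n) : bool :=
  (deadline I j < deadline I j') ||
  (deadline I j == deadline I j') &&
    ((release I j < release I j') ||
     (release I j == release I j') && (j <= j')%N).

(* The jobs run by EDF from [z] to [z + 1], most urgent first, when each job
   [j] has received [w j] units so far. *)
Definition edf_select (k n : nat) (I : instance n) (z : int)
  (w : 'I_n -> nat) : seq 'I_n :=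
  take k (sort (edf_le I)
    [seq j <- enum 'I_n | (release I j <= z) && (w j < proc I j)%N]).

(* An integer time before which no job is released; EDF idles until then. *)
Definition edf_start (n : nat) (I : instance n) : int :=
  \big[Num.min/0]_(j < n) release I j.

Fixpoint edf_work (k n : nat) (I : instance n) (s : nat) : 'I_n -> nat :=
  if s is s'.+1 then
    fun j => (edf_work k I s' j +
      (j \in edf_select k I (edf_start I + s'%:Z) (edf_work k I s')))%N
  else fun=> 0%N.

Definition edf_jobs (k n : nat) (I : instance n) (z : int) : seq 'I_n :=
  if edf_start I <= z
  then edf_select k I z (edf_work k I `|z - edf_start I|%N)
  else [::].

(* Jobs are not dropped at their deadlines: if EDF is late with a job, the
   schedule violates [feasible_window]. *)
Definition edf (R : realType) (k n : nat) (I : instance n) :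
    schedule R k n :=
  fun i t => onth (edf_jobs k I (Num.floor t)) i.
Arguments edf R k [n] I i t.

Definition edf_algorithm (R : realType) (K : nat -> nat) : algorithm R K :=
  fun m n I => edf R (K m) I.
Arguments edf_algorithm R K m [n] I i t.

(* Main.v *)
(* Fix a job [j] that EDF finishes late, and count only jobs at least as urgent
   as [j], all of processing time [p]. In total EDF never lags behind a feasible
   schedule on [m] machines by more than [m p] units, and this implies that at
   most [3 m] of these jobs are released and unfinished at a time [s] if all of
   them are due by [s + p]. But [j], being late, waits unfinished at some time
   [s] of the last [p] units before its deadline; then the [3 m] machines run
   more urgent jobs, so that together with [j] there are [3 m + 1] such jobs. *)

Require Import Defs.
From mathcomp Require Import all_boot all_order all_algebra.
From mathcomp Require Import zify ring lra.
From mathcomp Require Import all_classical all_reals all_analysis.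

Set Implicit Arguments.
Unset Strict Implicit.
Unset Printing Implicit Defensive.

Import Order.TTheory GRing.Theory Num.Theory.

(** * Two counting facts *)

Lemma leq_telescope (f : nat -> nat) (c a b : nat) : (a <= b)%N ->
  (forall s, (a <= s < b)%N -> (f s + c <= f s.+1)%N) ->
  (f a + c * (b - a) <= f b)%N.
Proof.
move=> ab fS; rewrite -(subnKC ab); have : (b - a <= b - a)%N by [].
elim: {1 3 4}(b - a) => [|d IHd] db; first by rewrite addn0 subnn muln0 addn0.
have := fS (a + d)%N; have := IHd (ltnW db); rewrite addnS => ?.
by move/(_ ltac:(lia)); nia.
Qed.

(** Greedy construction: an element of [Q :\: P] minimizing [f] joins [P] until [P] has [c]
    elements. *)
Lemma exists_smallest_subset (T : finType) (f : T -> nat) (Q : {set T}) c :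
  (c <= #|Q|)%N -> exists P : {set T}, [/\ P \subset Q, #|P| = c &
    {in P & Q :\: P, forall x y, (f x <= f y)%N}].
Proof.
elim: c => [|c IHc] cQ.
  exists finset.set0; split; rewrite ?finset.sub0set ?cards0 //.
  by move=> x y; rewrite finset.in_set0.
have [P [PQ Pc Pmin]] := IHc (ltnW cQ).
have /card_gt0P[x0 x0Q] : (0 < #|Q :\: P|)%N.
  by rewrite cardsD (finset.setIidPr PQ) Pc subn_gt0.
case: (arg_minnP f x0Q) => x /finset.setDP[xQ xP] xmin.
exists (x |: P); split; first by rewrite finset.subUset finset.sub1set xQ.
  by rewrite cardsU1 xP Pc.
move=> y z; rewrite !inE negb_or => /predU1P[->|yP] /andP[/andP[_ zP] zQ].
  by apply: xmin; apply/finset.setDP.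
by apply: Pmin => //; rewrite inE zP.
Qed.

(** * Lag and number of active jobs in a discrete model *)

Section WorkConserving.

(** Time runs in unit steps: [E s] is the set of jobs that the algorithm runs in step [s], and
    [w s i] the work done on [i] before that step. [O s i] is the work of a competing schedule on
    [m] machines; it is real because that schedule may preempt at any real time. For EDF, [J] will
    be the jobs at least as urgent as a given one: this yields [E_full] although [E s] may also
    contain jobs outside [J]. *)
Variables (R : realFieldType) (T : finType) (J : {set T}) (arr : T -> nat).
Variables (E : nat -> {set T}) (w : nat -> T -> nat) (O : nat -> T -> R).
Variables (m p : nat).

Definition active (s : nat) : {set T} :=
  [set i in J | (arr i <= s)%N && (w s i < p)%N].

Hypothesis w0 : forall i, w 0 i = 0%N.
Hypothesis wS : forall s i, w s.+1 i = (w s i + (i \in E s))%N.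
Hypothesis E_ready : forall s i, i \in E s -> (arr i <= s)%N && (w s i < p)%N.
Hypothesis E_full :
  forall s, (active s \subset E s) || (3 * m <= #|E s :&: J|)%N.
Hypothesis O_before : forall s i, (s <= arr i)%N -> O s i = 0%R.
Hypothesis O_le : forall s i, (O s i <= p%:R)%R.
Hypothesis O_rate :
  forall s, (\sum_(i in J) O s.+1 i <= \sum_(i in J) O s i + m%:R)%R.

Lemma work_mono s t i : (s <= t)%N -> (w s i <= w t i)%N.
Proof.
move=> st; have := @leq_telescope (fun s => w s i) 0 _ _ st.
by rewrite mul0n addn0; apply=> u _; rewrite wS addn0 leq_addr.
Qed.

Lemma work_before s i : (s <= arr i)%N -> w s i = 0%N.
Proof.
elim: s => // s IHs sr; rewrite wS IHs ?(ltnW sr)//.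
by case: (boolP (i \in E s)) => // /E_ready /andP[]; rewrite leqNgt sr.
Qed.

Lemma work_le s i : (w s i <= p)%N.
Proof.
elim: s => [|s IHs]; first by rewrite w0.
rewrite wS; case: (boolP (i \in E s)) => [/E_ready /andP[_]|_];
  by rewrite ?addn1 ?addn0.
Qed.

Lemma sum_workS (N : {set T}) s :
  (\sum_(i in N) w s.+1 i = \sum_(i in N) w s i + #|E s :&: N|)%N.
Proof.
under eq_bigr do rewrite wS; rewrite big_split; congr addn.
by rewrite -big_mkcondr sum1dep_card; apply: eq_card => i; rewrite !inE andbC.
Qed.

Lemma sum_opt_rate a b : (a <= b)%N ->
  (\sum_(i in J) O b i <= \sum_(i in J) O a i + (m * (b - a))%:R)%R.
Proof.
move=> /subnKC <-; elim: (b - a)%N => [|d IHd].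
  by rewrite addn0 subnn muln0 addr0.
rewrite addnS; apply: le_trans (O_rate _) _.
rewrite (_ : (a + d).+1 - a = (a + d - a).+1)%N; last by lia.
by rewrite mulnS natrD; lra.
Qed.

Lemma active_before s t i : i \in J -> (arr i <= s)%N -> (s <= t)%N ->
  (w t i < p)%N -> i \in active s.
Proof.
by move=> iJ ris st wt; rewrite inE iJ ris (leq_ltn_trans (work_mono _ st)).
Qed.

(* If the algorithm lagged by more than [m p], more than [m] jobs would lag,
   and since the last of their releases at least [m] jobs would have been run
   at each time, so that the lag would already have been as large then. *)
Lemma lag_le t :
  (\sum_(i in J) O t i <= (\sum_(i in J) w t i)%:R + (m * p)%:R)%R.
Proof.
elim/ltn_ind: t => t IHt; rewrite leNgt; apply/negP => lag.
pose Q := [set i in J | ((w t i)%:R < O t i)%R].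
(* Jobs outside [Q] do not lag and a job of [Q] lags by at most [p], so a total lag above [m * p]
   takes more than [m] jobs. *)
have mQ : (m < #|Q|)%N.
  have : ((m * p)%:R < (#|Q| * p)%:R :> R)%R.
    have lagE : ((m * p)%:R < \sum_(i in J) (O t i - (w t i)%:R))%R.
      by rewrite sumrB -natr_sum; lra.
    apply: lt_le_trans lagE _.
    rewrite (bigID (fun i => ((w t i)%:R < O t i)%R)) /= natrM -[leRHS]addr0.
    apply: lerD.
      rewrite mulr_natl -sumr_const [leRHS](eq_bigl
        (fun i => (i \in J) && ((w t i)%:R < O t i)%R)); last first.
        by move=> i; rewrite inE.
      apply: ler_sum => i _; have := O_le t i.
      by have : (0 <= (w t i)%:R :> R)%R by []; lra.
    by apply: sumr_le0 => i /andP[_]; rewrite -leNgt; lra.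
  by rewrite ltr_nat ltn_mul2r => /andP[].
have /card_gt0P[i0 i0Q] : (0 < #|Q|)%N by apply: leq_ltn_trans mQ.
have [i1 i1Q i1max] := arg_maxnP arr i0Q; rewrite -/(i1 \in Q) in i1Q.
have Qp i : i \in Q -> (w t i < p)%N.
  by rewrite inE => /andP[_ lt]; rewrite -(ltr_nat R) (lt_le_trans lt).
(* Strict, because [O t i1] is positive while [O] vanishes up to the release; so the induction
   hypothesis applies at [arr i1]. *)
have r1t : (arr i1 < t)%N.
  rewrite ltnNge; apply/negP => tr.
  by move: i1Q; rewrite inE (O_before tr) ltrn0 andbF.
have wt : (\sum_(i in J) w (arr i1) i + m * (t - arr i1)
           <= \sum_(i in J) w t i)%N.
  apply: (@leq_telescope (fun s => \sum_(i in J) w s i)%N); first exact: ltnW.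
  move=> s /andP[rs st]; rewrite sum_workS leq_add2l.
  have QA : Q \subset active s.
    apply/fintype.subsetP => i iQ.
    apply: (active_before _ _ (ltnW st) (Qp _ iQ)).
      by move: iQ; rewrite inE => /andP[].
    exact: leq_trans (i1max _ iQ) rs.
  case/orP: (E_full s) => [AE|]; last by lia.
  apply: leq_trans (ltnW mQ) (subset_leq_card _).
  rewrite finset.subsetI (fintype.subset_trans QA AE).
  by apply/fintype.subsetP => i; rewrite inE => /andP[].
have := IHt _ r1t; have := sum_opt_rate (ltnW r1t).
by move: wt; rewrite -(ler_nat R) natrD; lra.
Qed.

(* Of [3 m + 1] active jobs, let [P] be the [m] earliest released and [u] the
   first released of the others, [L]. From the release of [u] on, the jobs
   outside [L] together receive at least [m] units at each time, less one if [u]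
   runs: either all active jobs run, including [P], or at most [2 m] of the
   [3 m] machines run jobs of [L :\ u]. By [lag_le] at the release of [u], those
   jobs do not have that much work, since before [s + p] the [m] machines of the
   feasible schedule also spend [(2 m + 1) p] units on [L]. *)
Lemma active_le s : {in J, forall i, O (s + p) i = p%:R%R} ->
  (#|active s| <= 3 * m)%N.
Proof.
move=> O_done; rewrite leqNgt; apply/negP => big.
have [Q [QA Qc _]] := exists_smallest_subset arr big.
have [P [PQ Pc Pmin]] : exists P : {set T}, [/\ P \subset Q, #|P| = m &
    {in P & Q :\: P, forall x y, (arr x <= arr y)%N}].
  by apply: exists_smallest_subset; lia.
pose L := Q :\: P; pose N := J :\: L.
have cardL : #|L| = (2 * m).+1 by rewrite cardsD (finset.setIidPr PQ); lia.
have /card_gt0P[u0 u0L] : (0 < #|L|)%N by rewrite cardL.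
have [u uL umin] := arg_minnP arr u0L; rewrite -/(u \in L) in uL.
have act i : i \in Q -> [&& i \in J, (arr i <= s)%N & (w s i < p)%N].
  by move/(fintype.subsetP QA); rewrite inE.
have LQ : L \subset Q by apply: finset.subsetDl.
have LJ : L \subset J.
  by apply/fintype.subsetP => i /(fintype.subsetP LQ) /act /andP[].
have [uJ rus wsu] := and3P (act _ (fintype.subsetP LQ _ uL)).
have NJ : (#|J| = #|N| + #|L|)%N.
  by rewrite cardsD (finset.setIidPr LJ) subnK // subset_leq_card.
have sumJ (f : T -> nat) :
    (\sum_(i in J) f i = \sum_(i in N) f i + \sum_(i in L) f i)%N.
  rewrite (big_setID L) /= (finset.setIidPr LJ) addnC; congr addn.
have step t : (arr u <= t < s)%N ->
    ((\sum_(i in N) w t i + w t u) + m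
     <= \sum_(i in N) w t.+1 i + w t.+1 u)%N.
  move=> /andP[rt ts].
  have actP i : i \in P -> i \in active t.
    move=> iP; have [iJ _ wsi] := and3P (act _ (fintype.subsetP PQ _ iP)).
    apply: active_before (ltnW ts) wsi => //.
    exact: leq_trans (Pmin _ _ iP uL) rt.
  rewrite sum_workS wS.
  suff : (m <= #|E t :&: N| + (u \in E t))%N by lia.
  case/orP: (E_full t) => [AE|full].
    rewrite -Pc; apply: leq_trans (leq_addr _ _); apply: subset_leq_card.
    apply/fintype.subsetP => i iP.
    have [iJ _ _] := and3P (act _ (fintype.subsetP PQ _ iP)).
    by rewrite !inE iP iJ (fintype.subsetP AE) ?actP.
  have EJ : (#|E t :&: J| <= #|E t :&: N| + #|E t :&: L|)%N.
    apply: leq_trans (leq_card_setU _ _).1; apply: subset_leq_card.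
    rewrite -finset.setIUr finset.setIS //; apply/fintype.subsetP => i iJ.
    by rewrite finset.in_setU finset.in_setD iJ andbT orNb.
  have : (#|E t :&: L| <= (u \in E t) + #|L :\ u|)%N.
    rewrite (cardsD1 u) inE uL andbT leq_add2l; apply: subset_leq_card.
    by rewrite finset.setSD // finset.subsetIr.
  by have := cardsD1 u L; rewrite uL cardL; lia.
have wN := @leq_telescope (fun t => \sum_(i in N) w t i + w t u)%N
  m _ _ rus step.
have wN0 : (\sum_(i in J) w (arr u) i = \sum_(i in N) w (arr u) i)%N.
  rewrite sumJ [X in (_ + X)%N]big1 ?addn0 // => i iL.
  by rewrite work_before // umin.
have wNs : (\sum_(i in N) w s i <= #|N| * p)%N.
  by rewrite -sum_nat_const; apply: leq_sum => i _; apply: work_le.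
have sp : (arr u <= s + p)%N by lia.
have opt : (#|J| * p <= \sum_(i in N) w (arr u) i + m * p
                          + m * (s + p - arr u))%N.
  have := sum_opt_rate sp; have := lag_le (arr u).
  rewrite wN0 (eq_bigr (fun=> p%:R%R) O_done) sumr_const -(ler_nat R).
  by rewrite natrM mulr_natl !natrD; lra.
(* The multiples of [s - arr u] cancel between [wN] and [opt], leaving
   [(2 * m + 1) * p <= 2 * m * p + w s u], against [w s u < p]. *)
move: wN opt; rewrite NJ cardL (work_before (leqnn _)) /=; nia.
Qed.

End WorkConserving.

Local Open Scope ring_scope.

(** * EDF as an instance of the discrete model *)

Lemma edf_le_total (n : nat) (I : instance n) : total (edf_le I).
Proof. by move=> i j; rewrite /edf_le; lia. Qed.

Lemma edf_le_trans (n : nat) (I : instance n) : transitive (edf_le I).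
Proof. by move=> j i l; rewrite /edf_le; lia. Qed.

Lemma edf_le_anti (n : nat) (I : instance n) : antisymmetric (edf_le I).
Proof. by move=> i j ij; apply/val_inj; move: ij; rewrite /edf_le /=; lia. Qed.

Lemma edf_select_uniq k n (I : instance n) z w : uniq (edf_select k I z w).
Proof. by rewrite take_uniq // sort_uniq filter_uniq // enum_uniq. Qed.

Lemma edf_select_ready k n (I : instance n) z w j :
  j \in edf_select k I z w -> (release I j <= z) && (w j < proc I j)%N.
Proof. by move=> /mem_take; rewrite mem_sort mem_filter => /andP[]. Qed.

(** A ready job of [J] cut off by [take] stands behind all selected jobs in the sorted list. These
    are thus at least as urgent, hence in [J], and there are [k] of them since something was
    dropped. *)
Lemma edf_select_full k n (I : instance n) z w (J : {set 'I_n}) :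
  (forall i j, j \in J -> edf_le I i j -> i \in J) ->
  ([set j in J | (release I j <= z) && (w j < proc I j)%N]
     \subset [set j in edf_select k I z w]) ||
  (k <= #|[set j in edf_select k I z w] :&: J|)%N.
Proof.
move=> Jdown; case: fintype.subsetP => //= sub.
have /existsNP[a /not_implyP[]] : ~ (forall a,
    a \in [set j in J | (release I j <= z) && (w j < proc I j)%N] ->
    a \in [set j in edf_select k I z w]) by move=> h; apply: sub.
rewrite !inE => /andP[aJ aready] /negP a_sel.
set l := [seq j <- enum 'I_n | (release I j <= z) && (w j < proc I j)%N].
have al : a \in sort (edf_le I) l.
  by rewrite mem_sort mem_filter aready mem_enum.
have := sort_sorted (@edf_le_total _ I) l.
rewrite (sorted_pairwise (@edf_le_trans _ I)) -(cat_take_drop k (sort _ _)).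
rewrite pairwise_cat => /andP[/allrelP le_sel _].
move: al; rewrite -{1}(cat_take_drop k (sort _ _)) mem_cat (negPf a_sel) /=.
move=> ad.
have -> : [set j in edf_select k I z w] :&: J = [set j in edf_select k I z w].
  apply/finset.setIidPl/fintype.subsetP => i; rewrite inE => isel.
  exact: Jdown aJ (le_sel _ _ isel ad).
rewrite cardsE (card_uniqP (edf_select_uniq _ _ _ _)) size_take.
by case: ltnP => // sk; move: ad; rewrite drop_oversize.
Qed.

Lemma edf_start_le n (I : instance n) j : edf_start I <= release I j.
Proof. exact: bigmin_le. Qed.

Lemma edf_work_le k n (I : instance n) s j : (edf_work k I s j <= proc I j)%N.
Proof.
elim: s => //= s IHs; case: (boolP (j \in _)); last by rewrite addn0.
by move=> /edf_select_ready /andP[_]; rewrite addn1.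
Qed.

Definition jobs_before n (I : instance n) (j : 'I_n) : {set 'I_n} :=
  [set i | edf_le I i j].

(** Integer times become step numbers counted from [edf_start I]; by [edf_start_le] the absolute
    value is a plain difference. *)
Definition release_step n (I : instance n) (j : 'I_n) : nat :=
  `|release I j - edf_start I|%N.

Lemma release_stepE n (I : instance n) j s :
  (release_step I j <= s)%N = (release I j <= edf_start I + s%:Z).
Proof. by rewrite /release_step; have := edf_start_le I j; lia. Qed.

Definition edf_set k n (I : instance n) s : {set 'I_n} :=
  [set j in edf_select k I (edf_start I + s%:Z) (edf_work k I s)].

(** The feasible schedule enters only through the amounts [O s i] that it has done by step [s];
    [active_le] is then contradicted at a step where a late [j] waits. *)
Lemma edf_completes (R : realFieldType) n (I : instance n) (m p : nat)
    (O : nat -> 'I_n -> R) (j : 'I_n) :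
  (forall i, proc I i = p) ->
  release I j + p%:Z <= deadline I j ->
  (forall s i, (s <= release_step I i)%N -> O s i = 0) ->
  (forall s i, O s i <= p%:R) ->
  (forall s i, deadline I i <= edf_start I + s%:Z -> O s i = p%:R) ->
  (forall (J : {set 'I_n}) s,
     \sum_(i in J) O s.+1 i <= \sum_(i in J) O s i + m%:R) ->
  edf_work (3 * m) I `|deadline I j - edf_start I|%N j = p.
Proof.
move=> procE window O0 Op Odone Orate.
set N := `|_|%N; set w := edf_work (3 * m) I.
have wN := edf_work_le (3 * m) I N j; rewrite procE -/w in wN.
apply/eqP; rewrite eqn_leq wN leqNgt /=; apply/negP => late.
have wS s i : w s.+1 i = (w s i + (i \in edf_set (3 * m) I s))%N.
  by rewrite inE.
have ready s i : i \in edf_set (3 * m) I s ->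
    (release_step I i <= s)%N && (w s i < p)%N.
  by rewrite inE release_stepE -(procE i); apply: edf_select_ready.
have full s : (active (jobs_before I j) (release_step I) w p s
    \subset edf_set (3 * m) I s) ||
    (3 * m <= #|edf_set (3 * m) I s :&: jobs_before I j|)%N.
  rewrite (_ : active _ _ _ _ _ = [set i in jobs_before I j |
    (release I i <= edf_start I + s%:Z) && (w s i < proc I i)%N]); last first.
    by apply/finset.setP => i; rewrite !inE release_stepE procE.
  apply: edf_select_full => i i'; rewrite !inE => i'j ii'.
  exact: edf_le_trans ii' i'j.
have r0 := edf_start_le I j.
have NE : edf_start I + N%:Z = deadline I j by rewrite /N; lia.
(* Otherwise [j], released early enough by [window], would run in each of the last [p] steps before
   its deadline and be finished. *)
have [s [sN js jr sp]] : exists s, [/\ (s < N)%N, j \notin edf_set (3 * m) I s,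
    (release_step I j <= s)%N & (N <= s + p)%N].
  apply: contrapT => /forallNP none.
  have := @leq_telescope (fun s => w s j) 1 (N - p) N (leq_subr _ _).
  rewrite subKn; last by lia.
  case/(_ _)/Wrap => [s /andP[s1 s2]|]; last by lia.
  rewrite wS; case: (boolP (j \in _)) => // js; case: (none s); split => //.
    by rewrite release_stepE; lia.
  by lia.
have wsN : (w s j <= w N j)%N by exact: work_mono wS _ _ _ (ltnW sN).
have jact : j \in active (jobs_before I j) (release_step I) w p s.
  rewrite !inE jr (leq_ltn_trans wsN late).
  by rewrite /edf_le eqxx ltxx eqxx leqnn !orbT.
have := @active_le R _ (jobs_before I j) (release_step I) (edf_set (3 * m) I)
  w O m p (fun=> erefl) wS ready full O0 Op (Orate _) s.
(* A job at least as urgent as [j] is due by the deadline of [j], hence by step [s + p]. *)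
case/(_ _)/Wrap => [i|].
  by rewrite inE /edf_le => ij; apply: Odone; lia.
rewrite leqNgt => /negP; apply.
case/orP: (full s) => [/fintype.subsetP/(_ j jact)|fullJ].
  by rewrite (negPf js).
apply: leq_ltn_trans fullJ _; apply: proper_card; apply/properP; split.
  apply/fintype.subsetP => i; rewrite finset.in_setI => /andP[/ready iE iJ].
  by rewrite inE iJ.
by exists j; rewrite ?finset.in_setI ?(negPf js).
Qed.

(** * EDF depends only on the jobs released so far *)

Lemma map_val_filter_enum n N (P : pred 'I_n) : (n <= N)%N ->
  map val [seq j <- enum 'I_n | P j] =
  [seq a <- iota 0 N | oapp P false (insub a)].
Proof.
move=> /subnKC <-; rewrite iotaD filter_cat -val_enum_ord filter_map.
rewrite [X in _ ++ X](_ : _ = [::]) ?cats0; last first.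
  apply/eqP; rewrite -[_ == _]negbK -has_filter; apply/hasPn => a.
  by rewrite mem_iota => /andP[na _]; rewrite insubN // -leqNgt.
by congr map; apply: eq_filter => j /=; rewrite valK.
Qed.

Section Online.
Variables (R : realType) (t : R).

Definition same_known n n' (I : instance n) (I' : instance n') :=
  known I t =1 known I' t.

Lemma same_known_sym n n' (I : instance n) (I' : instance n') :
  same_known I I' -> same_known I' I.
Proof. by move=> h a; rewrite h. Qed.

Lemma known_val n (I : instance n) j : release I j <= Num.floor t ->
  known I t (val j) = Some (release I j, proc I j, deadline I j).
Proof. by rewrite floor_ge_int /known valK => ->. Qed.

Lemma same_known_job n n' (I : instance n) (I' : instance n') j :
  same_known I I' -> release I j <= Num.floor t ->
  exists j' : 'I_n', [/\ val j' = val j, release I' j' = release I j,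
    proc I' j' = proc I j & deadline I' j' = deadline I j].
Proof.
move=> same /known_val; rewrite same /known; case: insubP => // j' _ j'j.
by case: ifP => // _ [? ? ?]; exists j'.
Qed.

(* [edf_start] is a minimum over all jobs, unknown ones included, but these do
   not affect it as soon as some job is released. *)
Lemma edf_start_known n n' (I : instance n) (I' : instance n') j :
  same_known I I' -> release I j <= Num.floor t -> edf_start I' <= edf_start I.
Proof.
move=> same rj; have [j' [_ rj' _ _]] := same_known_job same rj.
apply/bigmin_geP; split=> [|i _]; first exact: bigmin_le_id.
have [ri|ri] := leP (release I i) (Num.floor t).
  by have [i' [_ <- _ _]] := same_known_job same ri; apply: edf_start_le.
apply: le_trans (edf_start_le I' j') _; rewrite rj'.
exact: le_trans rj (ltW ri).
Qed.

Definition agree n n' (I : instance n) (w : 'I_n -> nat) (w' : 'I_n' -> nat) :=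
  forall j j', val j = val j' -> release I j <= Num.floor t -> w j = w' j'.

Lemma agree_sym n n' (I : instance n) (I' : instance n') w w' :
  same_known I I' -> agree I w w' -> agree I' w' w.
Proof.
move=> same ww' j' j j'j rj'.
have [i [ij ri _ _]] := same_known_job (same_known_sym same) rj'.
have ij' : i = j by apply/val_inj; rewrite ij.
by apply/esym/ww' => //; rewrite -ij' ri.
Qed.

Lemma ready_known n n' (I : instance n) (I' : instance n') w w' z a :
  same_known I I' -> agree I w w' -> z <= Num.floor t ->
  oapp (fun j => (release I j <= z) && (w j < proc I j)%N) false (insub a) ->
  oapp (fun j => (release I' j <= z) && (w' j < proc I' j)%N) false (insub a).
Proof.
move=> same ww' zt; case: insubP => //= j _ <- /andP[rj wj].
have rjt := le_trans rj zt.
have [j' [j'j rj' pj' _]] := same_known_job same rjt.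
by rewrite -j'j valK /= rj' pj' rj -(ww' j).
Qed.

(** The EDF order on job indices, expressed through [known] alone, so that two instances with the
    same known jobs have the same order. *)
Definition known_le n (I : instance n) (a b : nat) : bool :=
  if (known I t a, known I t b) is (Some (r, _, d), Some (r', _, d'))
  then (d < d') || (d == d') && ((r < r') || (r == r') && (a <= b)%N)
  else false.

Lemma map_val_select k n (I : instance n) z w : z <= Num.floor t ->
  map val (edf_select k I z w) = take k (sort (known_le I)
    (map val [seq j <- enum 'I_n | (release I j <= z) && (w j < proc I j)%N])).
Proof.
move=> zt; rewrite /edf_select map_take; congr take.
have leE i j : release I i <= z -> release I j <= z ->
    known_le I (val i) (val j) = edf_le I i j.
  by move=> ri rj; rewrite /known_le !known_val //; apply: le_trans zt.
apply/esym/(@homo_sort_map_in _ _ [pred j | release I j <= z]).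
- by move=> i j ri rj; rewrite /= !leE //; apply: edf_le_anti.
- by move=> i j l ri rj rl; rewrite /= !leE //; apply: edf_le_trans.
- by move=> i j _ _; apply: edf_le_total.
- by move=> i j ri rj; rewrite leE.
- by apply/allP => j; rewrite mem_filter => /andP[/andP[]].
Qed.

(** The jobs of the two instances have different ordinal types, so the selections are compared as
    lists of indices: both are filters of [iota 0 (n + n')] sorted by [known_le], and filter and
    order coincide. *)
Lemma edf_select_known k n n' (I : instance n) (I' : instance n') w w' z :
  same_known I I' -> agree I w w' -> z <= Num.floor t ->
  map val (edf_select k I z w) = map val (edf_select k I' z w').
Proof.
move=> same ww' zt; rewrite !map_val_select //; congr take.
rewrite (map_val_filter_enum _ (leq_addr n' n)).
rewrite (map_val_filter_enum _ (leq_addl n n')).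
have -> : known_le I = known_le I'.
  by apply/funext => a; apply/funext => b; rewrite /known_le !same.
congr sort; apply: eq_filter => a; apply/idP/idP.
  exact: (ready_known same ww' zt).
exact: (ready_known (same_known_sym same) (agree_sym same ww') zt).
Qed.

Lemma edf_work_known k n n' (I : instance n) (I' : instance n') s :
  same_known I I' -> edf_start I = edf_start I' ->
  edf_start I + s%:Z <= Num.floor t ->
  agree I (edf_work k I s) (edf_work k I' s).
Proof.
move=> same start; elim: s => [//|s IHs] st j j' jj' rj /=.
have {}st : edf_start I + s%:Z <= Num.floor t by lia.
rewrite (IHs st j j') // -(mem_map val_inj) -[in RHS](mem_map val_inj).
by rewrite (edf_select_known _ same (IHs st) st) jj' start.
Qed.

Lemma edf_jobs_known k n n' (I : instance n) (I' : instance n') :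
  same_known I I' ->
  map val (edf_jobs k I (Num.floor t)) = map val (edf_jobs k I' (Num.floor t)).
Proof.
move=> same; have same' := same_known_sym same.
case: (pselect (exists j, release I j <= Num.floor t)) => [[j rj]|none].
  have [j' [_ rj' _ _]] := same_known_job same rj; rewrite -rj' in rj.
  have start : edf_start I = edf_start I'.
    apply/le_anti/andP; split; first exact: edf_start_known same' rj.
    by apply: (@edf_start_known _ _ _ _ j same); rewrite -rj'.
  have st : edf_start I' <= Num.floor t := le_trans (edf_start_le I' j') rj.
  rewrite /edf_jobs start st; apply: edf_select_known => //.
  by apply: edf_work_known => //; rewrite start; lia.
(* With no job released by [t] the two starts may differ, but nothing is ready in either
   instance. *)
have nil l (L : instance l) :
    ~ (exists j, release L j <= Num.floor t) ->
    edf_jobs k L (Num.floor t) = [::].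
  move=> noneL; case E: edf_jobs => [//|j s]; case: noneL; exists j.
  have : j \in edf_jobs k L (Num.floor t) by rewrite E mem_head.
  by rewrite /edf_jobs; case: ifP => // _ /edf_select_ready /andP[].
rewrite !nil // => -[j' rj']; apply: none.
by have [j [_ rj _ _]] := same_known_job same' rj'; exists j; rewrite rj.
Qed.

End Online.

Lemma edf_semi_online (R : realType) (K : nat -> nat) :
  semi_online (edf_algorithm R K).
Proof.
move=> m n n' I I' t same i.
by rewrite -!onth_map; congr onth; apply: edf_jobs_known.
Qed.

Local Open Scope classical_set_scope.
Local Open Scope ring_scope.

(** * Work done by a feasible schedule in continuous time *)

Section Optimum.
Variables (R : realType) (k n : nat) (I : instance n) (S : schedule R k n).
Hypothesis feasS : feasible I S.
Notation mu := (@lebesgue_measure R).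

Definition machine_set (i : 'I_k) (j : 'I_n) : set R :=
  [set t | S i t = Some j].

Lemma processedE j : processed S j = \big[setU/set0]_(i < k) machine_set i j.
Proof.
rewrite -(bigcup_pred xpredT); apply/seteqP; split => t [i]; first by exists i.
by move=> _; exists i.
Qed.

Lemma measurable_processed j : measurable (processed S j).
Proof.
by rewrite processedE; apply: bigsetU_measurable => i _;
  apply: feasible_measurable feasS i j.
Qed.

(** At the integer times of the EDF steps this serves as [O] in [edf_completes]; the measure is
    finite by [done_fin], so [fine] loses nothing. *)
Definition done_by (x : R) (j : 'I_n) : R :=
  fine (mu (processed S j `&` `]-oo, x])).

Lemma measurable_done x j : measurable (processed S j `&` `]-oo, x]).
Proof. by apply: measurableI => //; apply: measurable_processed. Qed.

Lemma measure_done_le x j :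
  (mu (processed S j `&` `]-oo, x]) <= (proc I j)%:R%:E)%E.
Proof.
rewrite -(feasible_volume feasS j); apply: le_measure; rewrite ?inE.
- exact: measurable_done.
- exact: measurable_processed.
- exact: subIsetl.
Qed.

Lemma done_fin x j : mu (processed S j `&` `]-oo, x]) \is a fin_num.
Proof.
by rewrite ge0_fin_numE // (le_lt_trans (measure_done_le _ _)) ?ltry.
Qed.

Lemma done_by_le x j : done_by x j <= (proc I j)%:R.
Proof. by rewrite -lee_fin fineK ?done_fin // measure_done_le. Qed.

Lemma done_by_before x j : x <= (release I j)%:~R -> done_by x j = 0.
Proof.
(* Windows are closed, so the set may contain the point [x] itself, but no more than this null
   set. *)
move=> xr; rewrite /done_by (@subset_measure0 _ _ _ mu _ [set x]) //.
- exact: measurable_done.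
- move=> t [[i /(feasible_window feasS) /andP[rt _]]] /=.
  rewrite in_itv /= => tx; apply/eqP; rewrite eq_le tx (le_trans xr) //.
- exact: lebesgue_measure_set1.
Qed.

Lemma done_by_deadline x j :
  (deadline I j)%:~R <= x -> done_by x j = (proc I j)%:R.
Proof.
move=> dx; rewrite /done_by setIidl ?(feasible_volume feasS) //.
move=> t [i /(feasible_window feasS) /andP[_ td]] /=.
by rewrite in_itv /= (le_trans td).
Qed.

(** Double counting: as no job runs in parallel with itself, its measure splits over the machines;
    on each machine the sets of distinct jobs are disjoint inside an interval of length 1. *)
Lemma measure_itv_processed (J : {set 'I_n}) (x : R) :
  (\sum_(j in J) mu (processed S j `&` `]x, (x + 1)%R]) <= k%:R%:E)%E.
Proof.
have mI i j : measurable (machine_set i j `&` `]x, (x + 1)%R]).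
  by apply: measurableI => //; apply: feasible_measurable feasS i j.
have -> : (\sum_(j in J) mu (processed S j `&` `]x, (x + 1)%R]) =
    \sum_(i < k) \sum_(j in J) mu (machine_set i j `&` `]x, (x + 1)%R]))%E.
  rewrite exchange_big /=; apply: eq_bigr => j _.
  rewrite processedE big_distrl /= measure_bigsetU_ord //.
    by move=> i; apply: mI.
  move=> i i' _ _ [t [[/= it _] [/= i't _]]].
  exact: feasible_nonparallel feasS _ _ _ _ it i't.
have -> : k%:R%:E = (\sum_(i < k) 1)%E :> \bar R.
  by rewrite sumEFin sumr_const card_ord.
apply: lee_sum => i _; rewrite -measure_bigsetU_ord; last 2 first.
- by move=> j; apply: mI.
- move=> j j' _ _ [t [[/= jt _] [/= j't _]]].
  by apply: Some_inj; rewrite -jt -j't.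
have -> : 1%E = mu `]x, (x + 1)%R] :> \bar R.
  rewrite lebesgue_measure_itv /= lte_fin ltrDl ltr01 -EFinB.
  by rewrite addrAC subrr add0r.
rewrite le_measure ?inE //.
  by apply: bigsetU_measurable => j _; apply: mI.
by rewrite -big_distrl /=; apply: subIsetr.
Qed.

Lemma done_by_rate (J : {set 'I_n}) x :
  \sum_(j in J) done_by (x + 1) j <= \sum_(j in J) done_by x j + k%:R.
Proof.
rewrite -lee_fin EFinD -!sumEFin.
under eq_bigr do rewrite fineK ?done_fin //.
under [in leRHS]eq_bigr do rewrite fineK ?done_fin //.
apply: le_trans (leeD2l _ (measure_itv_processed J x)).
rewrite -big_split; apply: lee_sum => j _.
rewrite (_ : [set` `]-oo, (x + 1)%R]] = `]-oo, x] `|` `]x, (x + 1)%R]);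
  last first.
  by rewrite -itv_bndbnd_setU // bnd_simp lerDl.
rewrite setIUr; apply: measureU2; first exact: measurable_done.
by apply: measurableI => //; apply: measurable_processed.
Qed.

(** The processed set lies in the window and has measure [proc I j]. Positivity matters: an empty
    window has measure 0, not the negative difference of its endpoints. *)
Lemma window_ge j : (0 < proc I j)%N ->
  release I j + (proc I j)%:Z <= deadline I j.
Proof.
move=> p0; pose r : R := (release I j)%:~R; pose d : R := (deadline I j)%:~R.
have sub : processed S j `<=` `[r, d].
  by move=> t [i] /(feasible_window feasS); rewrite /= in_itv.
have : (mu (processed S j) <= mu `[r, d])%E.
  by rewrite le_measure ?inE //; apply: measurable_processed.
rewrite (feasible_volume feasS) lebesgue_measure_itv /= lte_fin ltr_int.
case: ifPn => [_|_]; last first.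
  by rewrite lee_fin lern0 => /eqP p00; move: p0; rewrite p00.
rewrite -EFinB lee_fin -rmorphB /= pmulrn ler_int; lia.
Qed.

End Optimum.

(** * EDF as a schedule in continuous time *)

Lemma preimage_floor1 (R : realType) (z : int) :
  [set t : R | Num.floor t = z] = [set` `[z%:~R, (z + 1)%:~R[].
Proof.
apply/seteqP; split => t /=; rewrite in_itv /=; last exact: floor_def.
by move=> <-; exact: floor_itv.
Qed.

(** The set is a countable union of unit intervals; this makes every decision taken at integer times
    measurable. *)
Lemma measurable_floor_preimage (R : realType) (D : set int) :
  measurable [set t : R | D (Num.floor t)].
Proof.
rewrite (_ : [set t : R | _] =
    \bigcup_z [set t : R | Num.floor t = z /\ D z]); last first.
  by apply/seteqP; split => [t Dt|t [z _ [/= -> //]]]; exists (Num.floor t).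
apply: countable_bigcupT_measurable => // z.
case: (pselect (D z)) => Dz.
  rewrite (_ : [set t : R | _] = [set` `[z%:~R, (z + 1)%:~R[]) //.
  by rewrite -preimage_floor1; apply/seteqP; split => [t []|t].
by rewrite (_ : [set t : R | _] = set0) //; apply/seteqP; split => [t []|t].
Qed.

Section EDFSchedule.
Variables (R : realType) (k n : nat) (I : instance n).
Notation mu := (@lebesgue_measure R).

Lemma mem_edf_jobs j z : j \in edf_jobs k I z ->
  exists2 s : nat, z = edf_start I + s%:Z & j \in edf_set k I s.
Proof.
rewrite /edf_jobs; case: ifPn => // sz jz.
exists `|z - edf_start I|%N; first by lia.
by rewrite inE (_ : _ + _ = z) //; lia.
Qed.

Lemma edf_jobs_step s j :
  (j \in edf_jobs k I (edf_start I + s%:Z)) = (j \in edf_set k I s).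
Proof.
rewrite /edf_jobs inE ifT; last by lia.
by rewrite (_ : `|_|%N = s) //; lia.
Qed.

Lemma edf_work_mono s s' j : (s <= s')%N ->
  (edf_work k I s j <= edf_work k I s' j)%N.
Proof.
by apply: (@work_mono _ (edf_set k I)) => {}s i; rewrite inE.
Qed.

(** Links counted steps to Lebesgue measure: each step adds a whole unit interval if [j] is selected
    in it, and nothing otherwise. *)
Lemma measure_edf_run j N :
  mu [set t | j \in edf_jobs k I (Num.floor t) /\
              Num.floor t < edf_start I + N%:Z] = (edf_work k I N j)%:R%:E.
Proof.
elim: N => [|N IHN] /=.
  rewrite (_ : [set t | _] = set0) ?measure0 //; apply/seteqP; split => // t [].
  by move=> /mem_edf_jobs[s ->]; lia.
set z := edf_start I + N%:Z.
pose A := [set t : R | j \in edf_jobs k I (Num.floor t) /\ Num.floor t < z].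
pose B := [set t : R | j \in edf_jobs k I (Num.floor t) /\ Num.floor t = z].
rewrite (_ : [set t | _] = A `|` B); last first.
  apply/seteqP; split => t /=; rewrite /A /B /z /=.
    move=> [jt tN]; have [lt|ge] := ltP (Num.floor t) z; first by left.
    by right; split => //; rewrite /z in ge *; lia.
  by move=> [[jt tN]|[jt tN]]; split => //; lia.
have -> : mu (A `|` B) = (mu A + mu B)%E.
  apply: measureU.
  - exact: (measurable_floor_preimage (fun x => j \in edf_jobs k I x /\ x < z)).
  - exact: (measurable_floor_preimage (fun x => j \in edf_jobs k I x /\ x = z)).
  - by apply/seteqP; split => // t [[_ lt] [_ eq]]; move: lt; rewrite eq ltxx.
rewrite natrD EFinD IHN; congr (_ + _)%E; rewrite /B /z.
have := edf_jobs_step N j; rewrite inE => <-.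
case: (boolP (j \in _)) => jN.
  rewrite (_ : [set t | _] = [set t | Num.floor t = edf_start I + N%:Z]).
    rewrite preimage_floor1 lebesgue_measure_itv /= lte_fin ltr_int ltzD1 lexx.
    by rewrite -EFinB -rmorphB /= addrAC subrr add0r.
  by apply/seteqP; split => [t []//|t /= tN]; rewrite tN.
rewrite (_ : [set t | _] = set0) ?measure0 //.
apply/seteqP; split => // t [+ tN].
by rewrite tN (negPf jN).
Qed.

Lemma processed_edf j :
  processed (edf R k I) j = [set t | j \in edf_jobs k I (Num.floor t)].
Proof.
apply/seteqP; split => t; first by move=> [i it]; apply/onthP; exists i.
move=> /onthP[i it]; have ik : (i < k)%N.
  apply: leq_trans (_ : size (edf_jobs k I (Num.floor t)) <= k)%N.
    by rewrite -onthTE it.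
  rewrite /edf_jobs; case: ifP => // _; rewrite size_take.
  by case: ltnP => // /ltnW.
by exists (Ordinal ik).
Qed.

(** EDF never runs a finished job, so completion by the deadline keeps all runs of a job inside its
    window and fixes its volume. A job with processing time 0 never runs, whatever its window. *)
Lemma edf_feasible :
  (forall j, (0 < proc I j)%N -> edf_start I <= deadline I j /\
     edf_work k I `|deadline I j - edf_start I|%N j = proc I j) ->
  feasible I (edf R k I).
Proof.
move=> completes; split.
- move=> i j.
  exact: (measurable_floor_preimage
    (fun z => onth (edf_jobs k I z) i = Some j)).
- move=> i j t it; have : j \in edf_jobs k I (Num.floor t).
    by apply/onthP; exists i.
  move=> /mem_edf_jobs[s ts]; rewrite inE => /edf_select_ready /andP[rs ws].
  have [sd done] := completes j (leq_ltn_trans (leq0n _) ws).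
  have sN : (s < `|deadline I j - edf_start I|)%N.
    rewrite ltnNge; apply/negP => /(@edf_work_mono _ _ j).
    by rewrite done leqNgt ws.
  have /andP[ft tf] := floor_itv t; apply/andP; split.
    by apply: le_trans ft; rewrite ler_int ts.
  by apply: le_trans (ltW tf) _; rewrite ler_int ts; lia.
- move=> i i' j t it i't.
  have {}it : onth (edf_jobs k I (Num.floor t)) i = Some j := it.
  apply/val_inj; apply: (@onth_inj _ (edf_jobs k I (Num.floor t))).
  + by rewrite /edf_jobs; case: ifP => // _; apply: edf_select_uniq.
  + by rewrite gtn_min -!onthTE it ?orbT.
  + by rewrite it; apply/esym/i't.
- move=> j; rewrite processed_edf.
  have [N workN] : exists N, edf_work k I N j = proc I j.
    have [p0|p0] := posnP (proc I j); first by exists 0; rewrite p0.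
    by have [_] := completes j p0; eexists; eassumption.
  rewrite -workN -measure_edf_run; congr (mu _).
  apply/seteqP; split => t /=; last by case.
  move=> jt; split => //; have [s ts] := mem_edf_jobs jt.
  rewrite inE => /edf_select_ready /andP[_]; rewrite ts -workN ltNge => ws.
  by apply/negP => Ns; move: ws; rewrite ltnNge edf_work_mono //; lia.
Qed.

End EDFSchedule.

(** * The competitive ratio of EDF *)

Lemma edf_competitive (R : realType) :
  competitive 3%:R (edf_algorithm R (fun m : nat => (3 * m)%N))
    equal_processing_times.
Proof.
move=> m n I [p procE] [[S feasS] _]; split; first by rewrite natrM.
apply: edf_feasible => j p0.
have window := window_ge feasS p0; have start := edf_start_le I j.
split; first by lia.
(* The continuous feasible schedule is sampled at the integer times at which EDF decides. *)
pose at_step (s : nat) : R := (edf_start I + s%:Z)%:~R.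
rewrite procE in window *.
apply: (@edf_completes R _ I m p (fun s => done_by S (at_step s)) j procE
  window).
- move=> s i; rewrite /release_step => h; have := edf_start_le I i => ri.
  by rewrite (done_by_before feasS) // /at_step ler_int; lia.
- by move=> s i; rewrite -(procE i); exact: (done_by_le feasS).
- move=> s i h; rewrite -(procE i) (done_by_deadline feasS) //.
  by rewrite ler_int.
- move=> J s; rewrite (_ : at_step s.+1 = at_step s + 1); last first.
    by rewrite /at_step -addn1 PoszD addrA rmorphD.
  exact: (done_by_rate feasS).
Qed.

Local Close Scope classical_set_scope.

Theorem theorem8 (R : realType) :
  semi_online (edf_algorithm R (fun m : nat => (3 * m)%N)) /\
  competitive 3%:R (edf_algorithm R (fun m : nat => (3 * m)%N))
    equal_processing_times.
Proof. by split; [apply: edf_semi_online | apply: edf_competitive]. Qed.
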